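(* Let $(X,\|\cdot\|)$ be a real reflexive Banach space with dual $X^*$, let $f:X\to\mathbb{R}$ be fully Legendre, and let $A:X\to 2^{X^*}$ be a maximally monotone operator. Then for all $x\in X$, $\eta\in X^*$ and $\lambda>0$: (1) there exists a unique $y\in X$ such that $$\eta\in Ay+\frac{1}{\lambda}\left(\nabla f(y)-\nabla f(x)\right);$$ (2) there exists a unique pair $(y,\xi)\in X\times X^*$ such that $$\xi\in A(y)\quad\text{and}\quad \eta=\xi+\frac{1}{\lambda}\left(\nabla f(y)-\nabla f(x)\right).$$ Moreover, these satisfy $$y=(\nabla f+\lambda A)^{-1}\left(\lambda\eta+\nabla f(x)\right),\qquad \xi=\eta-\frac{1}{\lambda}\left(\nabla f(y)-\nabla f(x)\right),$$ where $(\nabla f+\lambda A)^{-1}$ is single-valued on $X^*$ (so that the right-hand side of the formula for $y$ is a point of $X$).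
   Context: A function $f:X\to(-\infty,\infty]$ on a real reflexive Banach space $X$ is called fully Legendre if it is lower semicontinuous, convex and Gâteaux differentiable (hence finite) on all of $X$, and its convex conjugate $f^*:X^*\to(-\infty,\infty]$, $f^*(x^* )=\sup\{\langle x^*,x\rangle-f(x):x\in X\}$, is Gâteaux differentiable (hence finite) on all of $X^*$. Here $\langle x^*,x\rangle=x^*(x)$ and $\nabla f$ is the Gâteaux derivative. A set-valued operator $A:X\to 2^{X^*}$ is monotone if $\langle x_1^*-x_2^*,x_1-x_2\rangle\ge 0$ whenever $x_1^*\in Ax_1$, $x_2^*\in Ax_2$; it is maximally monotone if its graph is not properly contained in the graph of another monotone operator. For $B:X\to 2^{X^*}$, $B^{-1}:X^*\to 2^X$ is $B^{-1}(w)=\{x\in X:w\in Bx\}$. Sums of sets are Minkowski sums (empty if one summand is empty), and $(A+B)x=Ax+Bx$, $(\lambda A)(x)=\lambda A(x)$. An operator is single-valued if each point of its source space has exactly one image; its value is then identified with that element. *)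

(* Defs.v *)
From HB Require Import structures.
From mathcomp Require Import all_boot all_order all_algebra.
From mathcomp Require Import all_classical all_reals.
From mathcomp Require Import all_analysis.

Set Implicit Arguments.
Unset Strict Implicit.
Unset Printing Implicit Defensive.

Import Order.TTheory GRing.Theory Num.Theory.
Import numFieldNormedType.Exports.

Local Open Scope classical_set_scope.
Local Open Scope ring_scope.

Section Dual.
Context {R : realType} {X : normedModType R}.

Definition continuous_linear : {pred X -> R^o} :=
  mem [set p : X -> R^o | linear p /\ continuous p].

Lemma continuous_linear_submod_closed : submod_closed continuous_linear.
Proof.
split.
  rewrite inE; split; last exact: cst_continuous.
  by move=> a u v; rewrite /GRing.zero/= scaler0 addr0.
move=> a p q; rewrite !inE => -[linp contp] [linq contq]; split.
  move=> b u v; rewrite !fctE linp linq !scalerDr !scalerA mulrC.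
  by rewrite addrACA.
move=> x; rewrite /continuous_at fctE; apply: cvgD; last exact: contq.
by apply: cvgZr; exact: contp.
Qed.

HB.instance Definition _ := GRing.isSubmodClosed.Build R (X -> R^o)
  continuous_linear continuous_linear_submod_closed.

(* The topological dual X^*: [p x] is the duality pairing <p, x>. *)
Record dual : Type := Dual {
  dual_fun :> X -> R^o;
  _ : dual_fun \in continuous_linear }.

HB.instance Definition _ := [isSub for dual_fun].
HB.instance Definition _ := [Choice of dual by <:].
HB.instance Definition _ := [SubChoice_isSubLmodule of dual by <:].

Implicit Types (p q : dual) (x y : X).

Lemma dualP p : linear p /\ continuous p.
Proof. by case: p => p /= /set_mem. Qed.

HB.instance Definition _ p := GRing.isLinear.Build R X R^o _ p (proj1 (dualP p)).

Lemma dual_continuous p : continuous p.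
Proof. exact: (proj2 (dualP p)). Qed.

Lemma dual_eqP p q : p =1 q -> p = q.
Proof. by move=> pq; apply/val_inj/funext. Qed.

Lemma dual0E x : (0 : dual) x = 0.
Proof. by []. Qed.

Lemma dualDE p q x : (p + q) x = p x + q x.
Proof. by []. Qed.

Lemma dualNE p x : (- p) x = - p x.
Proof. by []. Qed.

Lemma dualBE p q x : (p - q) x = p x - q x.
Proof. by []. Qed.

Lemma dualZE (a : R) p x : (a *: p) x = a * p x.
Proof. by []. Qed.

Definition dual_norm p : R := sup [set `|p x| | x in [set x : X | `|x| <= 1]].

Lemma dual_norm_has_sup p :
  has_sup [set `|p x| | x in [set x : X | `|x| <= 1]].
Proof.
split; first by exists `|p 0|; exists 0 => //=; rewrite normr0.
have /bounded_funP/(_ 1)[M pM] : bounded_near p (nbhs (0 : X)).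
  by apply/linear_bounded_continuous; exact: dual_continuous.
by exists M => _ [x x1 <-]; exact: pM.
Qed.

Lemma dual_norm_ub p x : `|x| <= 1 -> `|p x| <= dual_norm p.
Proof.
by move=> x1; apply: ub_le_sup; [exact: (dual_norm_has_sup p).2|exists x].
Qed.

Lemma dual_norm_le p (M : R) :
  (forall x, `|x| <= 1 -> `|p x| <= M) -> dual_norm p <= M.
Proof.
move=> pM; apply: ge_sup; first exact: (dual_norm_has_sup p).1.
by move=> _ [x x1 <-]; exact: pM.
Qed.

Lemma dual_norm_ge0 p : 0 <= dual_norm p.
Proof. by apply: le_trans (dual_norm_ub p (x := 0) _); rewrite ?normr0. Qed.

Lemma dual_normP p x : `|p x| <= dual_norm p * `|x|.
Proof.
have [->|x0] := eqVneq x 0; first by rewrite linear0 !normr0 mulr0.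
have nx0 : 0 < `|x| by rewrite normr_gt0.
have := @dual_norm_ub p (`|x|^-1 *: x).
rewrite linearZ/= !normrZ normfV normr_id mulVf ?gt_eqF// => /(_ (lexx _)).
by rewrite mulrC ler_pdivrMr.
Qed.

Lemma dual_ler_normD p q : dual_norm (p + q) <= dual_norm p + dual_norm q.
Proof.
apply: dual_norm_le => x x1; rewrite dualDE (le_trans (ler_normD _ _))//.
by rewrite lerD// dual_norm_ub.
Qed.

Lemma dual_normrZ (a : R) p : dual_norm (a *: p) = `|a| * dual_norm p.
Proof.
have leZ b q : dual_norm (b *: q) <= `|b| * dual_norm q.
  apply: dual_norm_le => x x1.
  by rewrite dualZE normrM ler_wpM2l// dual_norm_ub.
apply/le_anti; rewrite leZ/=.
have [->|a0] := eqVneq a 0; first by rewrite normr0 mul0r dual_norm_ge0.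
have := leZ a^-1 (a *: p); rewrite scalerA mulVf// scale1r normfV.
by rewrite ler_pdivlMl ?normr_gt0.
Qed.

Lemma dual_normr0_eq0 p : dual_norm p = 0 -> p = 0.
Proof.
move=> p0; apply: dual_eqP => x; apply/eqP.
by rewrite -normr_le0 (le_trans (dual_normP p x))// p0 mul0r.
Qed.

HB.instance Definition _ := @Lmodule_isNormed.Build R dual dual_norm
  dual_ler_normD dual_normrZ dual_normr0_eq0.

Lemma dual_normE p : `|p| = dual_norm p.
Proof. by []. Qed.

End Dual.
Arguments dual {R} X.

Section Definitions.
Context {R : realType}.
Implicit Types X : normedModType R.

(* The canonical embedding of X into its bidual is onto. *)
Definition reflexive_space X :=
  forall phi : dual (dual X), exists x : X, forall p : dual X, phi p = p x.

(* p is the Gateaux derivative of f at x. *)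
Definition is_gateaux X (f : X -> R) (x : X) (p : dual X) :=
  forall v : X, is_derive x v (f : X -> R^o) (p v).

Definition gateaux_differentiable X (f : X -> R) :=
  forall x, exists p : dual X, is_gateaux f x p.

(* The value is meaningful only where f is Gateaux differentiable. *)
Definition grad X (f : X -> R) (x : X) : dual X := xget 0 (is_gateaux f x).

Lemma is_gateaux_unique X (f : X -> R) (x : X) (p q : dual X) :
  is_gateaux f x p -> is_gateaux f x q -> p = q.
Proof.
by move=> fp fq; apply: dual_eqP => v; rewrite -(@derive_val _ _ _ _ _ _ _ (fp v))
  -(@derive_val _ _ _ _ _ _ _ (fq v)).
Qed.

Lemma is_gateaux_grad X (f : X -> R) :
  gateaux_differentiable f -> forall x, is_gateaux f x (grad f x).
Proof. by move=> df x; exact: xgetPex (df x). Qed.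

Definition conjugate X (f : X -> R) (p : dual X) : \bar R :=
  ereal_sup [set (p x - f x)%:E | x in [set: X]].

(* Gateaux differentiability on the whole space presupposes finite values
   everywhere: f is therefore real-valued from the start, and finiteness of
   its conjugate is required before taking the real part. *)
Definition fully_legendre X (f : X -> R) :=
  [/\ lower_semicontinuous (fun x : X => (f x)%:E),
      convex_function [set: X] f,
      gateaux_differentiable f,
      (forall p : dual X, conjugate f p \is a fin_num) &
      gateaux_differentiable (fine \o conjugate f)].

End Definitions.

Section SetValuedOperators.
Context {R : realType} {X : normedModType R}.
Implicit Types A B : X -> set (dual X).

Definition monotone A := forall (x1 x2 : X) (p1 p2 : dual X),
  A x1 p1 -> A x2 p2 -> 0 <= (p1 - p2) (x1 - x2).

Definition graph A : set (X * dual X) := [set z | A z.1 z.2].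

Definition maximally_monotone A :=
  monotone A /\ forall B, monotone B -> ~ (graph A `<` graph B).

End SetValuedOperators.

Definition op_inv {U V : Type} (B : U -> set V) (w : V) : set U :=
  [set u | B u w].

(* The value of a single-valued operator B at u is the v with B u = [set v]. *)
Definition single_valued {U V : Type} (B : U -> set V) :=
  forall u, exists! v, B u v.

Definition set_add {V : nmodType} (S T : set V) : set V :=
  [set s + t | s in S & t in T].

Definition op_add {U : Type} {V : nmodType} (A B : U -> set V) : U -> set V :=
  fun u => set_add (A u) (B u).

Definition op_scale {R : pzRingType} {U : Type} {V : lmodType R} (a : R)
  (A : U -> set V) : U -> set V := fun u => [set a *: v | v in A u].

Definition op_fun {U V : Type} (g : U -> V) : U -> set V := fun u => [set g u].

(* Main.v *)
(* Surjectivity of grad f + lambda A is a Hahn-Banach argument. Let B be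
   lambda A shifted by w, let F(x, p) be the Fitzpatrick function of B, i.e. the
   supremum of <q, x> + <p, a> - <q, a> over the graph of B, and let
   g(x, p) = f x + f^* (- p). Maximality gives F(x, p) >= <p, x>, hence
   F + g >= 0 by Fenchel-Young, so an affine function l satisfies -g <= l <= F.
   By Baire's theorem f and f^* are bounded above on some ball, so l is
   continuous and, X being reflexive, l(x, p) = - <p1, x> + <p, y> + c. Then
   l <= F says that (y, - p1) is monotonically related to B, hence in its graph,
   and -g <= l is equality in Fenchel-Young, that is p1 = grad f y.
   Uniqueness: if <grad f y1 - grad f y2, y1 - y2> <= 0, both y1 and y2 are
   subgradients of f^* at grad f y2, where f^* is Gateaux differentiable. *)
Require Import Defs.
From HB Require Import structures.
From mathcomp Require Import all_boot all_order all_algebra.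
From mathcomp Require Import all_classical all_reals.
From mathcomp Require Import all_analysis.
From mathcomp Require Import ring lra.

Set Implicit Arguments.
Unset Strict Implicit.
Unset Printing Implicit Defensive.

Import Order.TTheory GRing.Theory Num.Theory.
Import numFieldNormedType.Exports.

Local Open Scope classical_set_scope.
Local Open Scope ring_scope.

(** * Algebraic Hahn-Banach theorem and an affine sandwich theorem *)

Section HahnBanach.
Context {R : realType} {V : lmodType R}.
Implicit Types (S : set (V * R)) (z : V) (c : R).

(** Stands in for the epigraph of a sublinear functional. By the last clause, the fibre over [z] is
    bounded below as soon as the fibre over [- z] is nonempty. *)
Definition graph_cone S := [/\
  forall z1 c1 z2 c2, S (z1, c1) -> S (z2, c2) -> S (z1 + z2, c1 + c2),
  forall a z c, 0 <= a -> S (z, c) -> S (a *: z, a * c) &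
  forall c, S (0, c) -> 0 <= c].

(** Zorn's lemma ranges over the sets [N] for which the union of [S] and [N] is a cone, rather than
    over cones containing [S]: the empty chain is then covered by [S] itself. *)
Lemma graph_cone_maximal S : graph_cone S -> exists M,
  [/\ graph_cone M, S `<=` M & forall N, graph_cone N -> M `<=` N -> N `<=` M].
Proof.
move=> coneS.
have [|M [coneM maxM]] := @Zorn_bigcup _ [set N | graph_cone (S `|` N)].
  move=> F Fcone Ftot.
  have in1 y : (S `|` \bigcup_(X in F) X) y -> S y \/ exists2 X, F X & X y.
    by case=> [|[X]]; [left|right; exists X].
  have out X y : F X -> (S `|` X) y -> (S `|` \bigcup_(X in F) X) y.
    by move=> FX [|]; [left|right; exists X].
  (* Totality of the chain puts two points into one common cone, so sums stay in the union. *)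
  have in2 y1 y2 : (S `|` \bigcup_(X in F) X) y1 ->
      (S `|` \bigcup_(X in F) X) y2 ->
      (S y1 /\ S y2) \/ exists2 X, F X & (S `|` X) y1 /\ (S `|` X) y2.
    move=> /in1[S1|[X FX Xy1]] /in1[S2|[Y FY Yy2]]; first by left.
    - by right; exists Y => //; split; [left|right].
    - by right; exists X => //; split; [right|left].
    - right; have [XY|YX] := Ftot _ _ FX FY.
        by exists Y => //; split; right; [exact: XY|].
      by exists X => //; split; right; [|exact: YX].
  split.
  - move=> z1 c1 z2 c2 /in2/[apply] -[[S1 S2]|[X FX [X1 X2]]].
      by left; case: coneS => + _ _; apply.
    by apply: (out _ _ FX); case: (Fcone _ FX) => + _ _; apply.
  - move=> a z c a0 /in1[Sz|[X FX Xz]].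
      by left; case: coneS => _ + _; apply.
    by apply: (out _ _ FX); case: (Fcone _ FX) => _ + _; apply => //; right.
  - move=> c /in1[Sz|[X FX Xz]].
      by case: coneS => _ _; apply.
    by case: (Fcone _ FX) => _ _; apply; right.
exists (S `|` M); split => // N coneN MN y Ny.
apply: contrapT => nMy; apply: (maxM N).
  split; last by move=> NM; apply: nMy; right; exact: NM.
  by move=> u Mu; apply: MN; right.
rewrite /= (_ : S `|` N = N)//.
by apply/seteqP; split => [u [Su|//]|u]; [apply: MN; left|right].
Qed.

(* Adding the ray through (-z, -c), with c the infimum of the fibre of M over
   z, keeps M a cone; maximality then makes M the epigraph of a linear form. *)
Lemma maximal_graph_cone_opp M : graph_cone M ->
    (forall N, graph_cone N -> M `<=` N -> N `<=` M) ->
    (forall z, exists c, M (z, c)) ->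
  forall z, exists c, [/\ M (- z, - c),
    forall d, M (z, d) -> c <= d &
    forall b, (forall d, M (z, d) -> b <= d) -> b <= c].
Proof.
move=> [Madd Mscale M0] Mmax Mdom z.
pose c := inf [set d | M (z, d)].
have infz : has_inf [set d | M (z, d)].
  split; first exact: Mdom.
  have [e Me] := Mdom (- z); exists (- e) => d /= Md.
  have := Madd _ _ _ _ Md Me; rewrite subrr => /M0; lra.
have cle d : M (z, d) -> c <= d by move=> Md; exact: ge_inf infz.2 _ Md.
exists c; split => //; last by move=> b bM; exact: lb_le_inf infz.1 bM.
apply: (Mmax [set y | exists2 t, 0 <= t & M (y.1 + t *: z, y.2 + t * c)]).
- split => /=.
  + move=> z1 c1 z2 c2 [t t0 Mt] [s s0 Ms]; exists (t + s); first exact: addr_ge0.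
    by have := Madd _ _ _ _ Mt Ms; rewrite addrACA -scalerDl addrACA -mulrDl.
  + move=> a y d a0 [t t0 Mt]; exists (a * t); first by rewrite mulr_ge0.
    by have := Mscale _ _ _ a0 Mt; rewrite scalerDr scalerA mulrDr mulrA.
  + move=> d [t]; rewrite add0r le_eqVlt => /predU1P[<-|t0 Mt].
      by rewrite scale0r mul0r addr0 => /M0.
    have := Mscale t^-1 _ _; rewrite invr_ge0 => /(_ _ _ (ltW t0) Mt).
    rewrite scalerA mulVf ?gt_eqF// scale1r mulrDr mulrA mulVf ?gt_eqF// mul1r.
    move=> /cle; rewrite lerDr pmulr_rge0// invr_gt0//.
- by move=> [y d] Md; exists 0 => //=; rewrite scale0r mul0r !addr0.
- exists 1 => //=; rewrite scale1r mul1r !addNr.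
  have [e Me] := Mdom 0.
  by have := Mscale 0 _ _ (lexx _) Me; rewrite scale0r mul0r.
Qed.

(* The functional is read off a maximal cone M as the c with (z, c) and
   (-z, -c) both in M. *)
Lemma graph_cone_dominated_linear S : graph_cone S ->
    (forall z, exists c, S (z, c)) ->
  exists2 l : V -> R^o, linear l & forall z c, S (z, c) -> l z <= c.
Proof.
move=> coneS Sdom.
have [M [coneM SM Mmax]] := graph_cone_maximal coneS.
have Mdom z : exists c, M (z, c) by have [c /SM] := Sdom z; exists c.
have [Madd Mscale M0] := coneM.
have /choice[l lM] := maximal_graph_cone_opp coneM Mmax Mdom.
have lNM z : M (- z, - l z) by case: (lM z).
have llb z d : M (z, d) -> l z <= d by case: (lM z) => _ + _; exact.
have lglb z b : (forall d, M (z, d) -> b <= d) -> b <= l z.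
  by case: (lM z) => _ _; exact.
have lN z : l (- z) = - l z.
  apply/eqP; rewrite eq_le llb//= lerNl; apply: (lglb) => d Md.
  rewrite lerNl; apply: (lglb) => e Me.
  have := Madd _ _ _ _ Md Me; rewrite subrr => /M0; lra.
(* Oddness of [l] shows that the infimum of each fibre is attained. *)
have lin z : M (z, l z) by have := lNM (- z); rewrite lN !opprK.
exists l; last by move=> z c /SM; exact: llb.
have lD u v : l (u + v) = l u + l v.
  apply/eqP; rewrite eq_le llb /=; last exact: Madd.
  have /llb := Madd _ _ _ _ (lNM u) (lNM v).
  rewrite -opprD lN; lra.
have lZ a v : 0 <= a -> l (a *: v) = a * l v.
  move=> a0; apply/eqP; rewrite eq_le llb /=; last exact: Mscale.
  have /llb := Mscale _ _ _ a0 (lNM v).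
  rewrite scalerN lN; lra.
move=> a u v; rewrite lD; congr +%R.
have [a0|a0] := leP 0 a; first exact: lZ.
rewrite -[a]opprK scaleNr lN lZ ?oppr_ge0 ?ltW//.
by rewrite scaleNr.
Qed.

Definition convex_fun (g : V -> R) := forall a b u v, 0 <= a -> 0 <= b ->
  a + b = 1 -> g (a *: u + b *: v) <= a * g u + b * g v.

(** [K] plays the epigraph of a convex function; as a set it needs no value at infinity. *)
Definition convex_graph (K : set (V * R)) := forall a b w1 t1 w2 t2, 0 <= a ->
  0 <= b -> a + b = 1 -> K (w1, t1) -> K (w2, t2) ->
  K (a *: w1 + b *: w2, a * t1 + b * t2).

(** The cone generated by the [(w - u, t + g u)] with [(w, t)] in [K] is nonnegative over 0 because
    [t + g w >= 0], and meets every fibre because [g] is finite everywhere. A linear minorant [l]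
    satisfies [l w - t <= l u + g u]; the supremum of the left side is [- c]. *)
Lemma affine_sandwich (K : set (V * R)) (g : V -> R) :
    convex_graph K -> convex_fun g -> K !=set0 ->
    (forall w t, K (w, t) -> 0 <= t + g w) ->
  exists2 l : V -> R^o, linear l & exists c,
    (forall u, - g u <= l u + c) /\ forall w t, K (w, t) -> l w + c <= t.
Proof.
move=> Kconv gconv [[w0 t0] K0] Kg.
pose S := [set y : V * R | exists r w t u, [/\ 0 <= r, K (w, t),
  y.1 = r *: (w - u) & y.2 = r * (t + g u)]].
(* Upward closure is needed for sums: convexity of [g] only gives an inequality there. *)
pose S' := [set y : V * R | exists2 c, S (y.1, c) & c <= y.2].
have [| |l llin lS] := @graph_cone_dominated_linear S'.
- split.
  + move=> z1 c1 z2 c2 [d1 [r1 [w1 [t1 [u1 [/= r10 K1 -> ->]]]]] c1d].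
    move=> [d2 [r2 [w2 [t2 [u2 [/= r20 K2 -> ->]]]]] c2d].
    have [r0|r0] := eqVneq (r1 + r2) 0.
      have r1E : r1 = 0 by lra.
      have r2E : r2 = 0 by lra.
      subst r1 r2; exists 0; last by rewrite /=; lra.
      by exists 0, w1, t1, u1; split => //=; rewrite ?scale0r ?addr0 ?mul0r.
    set r := r1 + r2 in r0.
    have rp : 0 <= r by exact: addr_ge0.
    have ab : r1 / r + r2 / r = 1 by rewrite -mulrDl divff.
    have a0 : 0 <= r1 / r by rewrite divr_ge0.
    have b0 : 0 <= r2 / r by rewrite divr_ge0.
    pose w := (r1 / r) *: w1 + (r2 / r) *: w2.
    pose u := (r1 / r) *: u1 + (r2 / r) *: u2.
    pose t := (r1 / r) * t1 + (r2 / r) * t2.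
    exists (r * (t + g u)).
      exists r, w, t, u; split => //=; first exact: Kconv.
      rewrite /w /u opprD addrACA -!scalerBr [RHS]scalerDr !scalerA.
      by rewrite !(mulrC r) !divfK.
    rewrite /=; apply: le_trans (lerD c1d c2d).
    have -> : r1 * (t1 + g u1) + r2 * (t2 + g u2) =
      r * (t + ((r1 / r) * g u1 + (r2 / r) * g u2)) by rewrite /t; field.
    by rewrite ler_wpM2l// lerD2l; exact: gconv.
  + move=> a z c a0 [d [r [w [t [u [/= r0 K1 -> ->]]]]] cd].
    exists (a * (r * (t + g u))); last by rewrite ler_wpM2l.
    by exists (a * r), w, t, u; split => //=; rewrite ?scalerA ?mulrA ?mulr_ge0.
  + move=> c [d [r [w [t [u [/= r0 K1 wu dE]]]]] /= dc].
    rewrite (le_trans _ dc)// dE; move/esym/eqP: wu; rewrite scaler_eq0.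
    move=> /orP[/eqP->|]; first by rewrite mul0r.
    by rewrite subr_eq0 => /eqP <-; rewrite mulr_ge0// Kg.
- move=> z; exists (t0 + g (w0 - z)), (t0 + g (w0 - z)) => //=.
  exists 1, w0, t0, (w0 - z); split => //=; last by rewrite mul1r.
  by rewrite scale1r subKr.
exists l => //.
have lB u v : l (u - v) = l u - l v.
  by rewrite -scaleN1r addrC llin scaleN1r addrC.
have lK w t u : K (w, t) -> l w - t <= l u + g u.
  move=> Kw; have : l (w - u) <= t + g u.
    apply: lS; exists (t + g u) => //=; exists 1, w, t, u.
    by split; rewrite ?scale1r ?mul1r.
  rewrite lB; lra.
pose E := [set l y.1 - y.2 | y in K].
have supE : has_sup E.
  split; first by exists (l w0 - t0), (w0, t0).
  by exists (l 0 + g 0) => _ [[w t] Kw <-]; exact: lK.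
exists (- sup E); split.
  move=> u; suff : sup E <= l u + g u by lra.
  by apply: ge_sup supE.1 _ => _ [[w t] Kw <-]; exact: lK.
move=> w t Kw; suff : l w - t <= sup E by lra.
by apply: ub_le_sup; [exact: supE.2|exists (w, t)].
Qed.
End HahnBanach.

(** * Continuity of linear forms, completeness of the dual, and Baire's theorem *)

Section Dual.
Context {R : realType}.

(** A one-sided bound on a single ball suffices: translating to 0 and using oddness bounds [l] in
    absolute value near 0, whence continuity. *)
Lemma linear_dual (X : normedModType R) (l : X -> R^o) (x0 : X) (r M : R) :
    linear l -> 0 < r -> (forall x, `|x - x0| < r -> l x <= M) ->
  exists p : dual X, forall x, p x = l x.
Proof.
move=> llin r0 lM.
pose L : {linear X -> R^o} :=
  HB.pack l (GRing.isLinear.Build R X R^o _ l llin).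
have lle x : `|x| < r -> l x <= M - l x0.
  move=> xr; have := lM (x + x0); rewrite addrK => /(_ xr).
  rewrite -[l]/(L : X -> R^o) linearD/=; lra.
have labs x : `|x| < r -> `|l x| <= M - l x0.
  move=> xr; rewrite ler_norml lle// andbT lerNl.
  by have := lle (- x); rewrite normrN -[l]/(L : X -> R^o) linearN; exact.
have cL : continuous L.
  apply/linear_bounded_continuous/bounded_funP => s.
  exists (2 * (`|s| + 1) / r * (M - l x0)) => x xs.
  have s0 : 0 < `|s| + 1 by rewrite ltr_wpDl.
  pose a := 2 * (`|s| + 1) / r; have a0 : 0 < a by rewrite divr_gt0// mulr_gt0.
  have -> : x = a *: (a^-1 *: x) by rewrite scalerA mulfV ?gt_eqF// scale1r.
  rewrite linearZ normrZ gtr0_norm// ler_wpM2l ?(ltW a0)//.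
  apply: labs; rewrite normrZ gtr0_norm ?invr_gt0// mulrC ltr_pdivrMr//.
  rewrite /a mulrC divfK ?gt_eqF//.
  have := ler_norm s; lra.
have lP : l \in (@continuous_linear R X) by rewrite inE; split.
by exists (Dual lP).
Qed.

Lemma dual_ball (X : normedModType R) (p q : dual X) (e : R) :
  ball p e q = (`|p - q| < e).
Proof. by rewrite -ball_normE. Qed.

(** Makes the dual complete, so that Baire's theorem applies to [f^*]. The limit is taken pointwise;
    comparison with a single [p1] bounds it on the unit ball, and the estimate [Lle], uniform on
    that ball, upgrades pointwise to norm convergence. *)
Lemma dual_cauchy_cvg (X : normedModType R) (F : set_system (dual X)) :
  ProperFilter F -> cauchy F -> cvg F.
Proof.
move=> FF /cauchyP Fc.
have Fx (x : X) (e : R) : 0 < e ->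
    exists p0 : dual X, F [set p : dual X | `|p0 x - p x| < e].
  move=> e0; have x0 : 0 < `|x| + 1 by rewrite ltr_wpDl.
  have [p0 Fp0] := Fc _ (divr_gt0 e0 x0); exists p0.
  apply: filterS Fp0 => p; rewrite dual_ball ltr_pdivlMr// => pe.
  apply: le_lt_trans pe; apply: le_trans (dual_normP (p0 - p) x) _.
  by rewrite dual_normE ler_wpM2l ?dual_norm_ge0// lerDl.
pose ev (x : X) (p : dual X) : R^o := p x.
pose L (x : X) : R^o := lim (ev x @ F).
have Lcvg x : ev x @ F --> L x.
  apply: cauchy_cvg; apply/cauchyP => e e0.
  have [p0 Fp0] := Fx x _ e0; exists (p0 x).
  by apply: (@filterS _ F _ _ _ _ Fp0) => p; rewrite /= -ball_normE.
have Llin : linear L.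
  move=> a u v; apply: cvg_lim => //.
  have -> : ev (a *: u + v) = (fun p => a *: ev u p + ev v p).
    by apply/funext => p; rewrite /ev linearP.
  by apply: cvgD; [apply: cvgZr|]; exact: Lcvg.
have Lle (p0 : dual X) e : 0 < e -> F (ball p0 e) ->
    forall x, `|p0 x - L x| <= e * `|x|.
  move=> e0 Fp0 x; apply/ler_addgt0Pr => d d0.
  have /cvgr_dist_lt/(_ _ d0) FL := Lcvg x.
  have [p [pL pp0]] := @filter_ex _ _ FF _ (filterI FL Fp0).
  rewrite -(subrK (p x : R) (p0 x)) -addrA (le_trans (ler_normD _ _))// lerD//.
    move: pp0; rewrite dual_ball => pp0.
    apply: le_trans (dual_normP (p0 - p) x) _.
    by rewrite ler_wpM2r// ltW.
  by rewrite distrC ltW.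
have [p1 Fp1] := Fc 1 ltr01.
have [q qL] : exists q : dual X, forall x, q x = L x.
  apply: (@linear_dual _ _ 0 1 (dual_norm p1 + 1) Llin ltr01) => x.
  rewrite subr0 => /ltW x1; have := Lle _ _ ltr01 Fp1 x; rewrite mul1r.
  have := dual_norm_ub p1 x1.
  rewrite !ler_norml => /andP[_ A1] /andP[A2 _]; lra.
suff : F --> q by move=> Fq; apply/cvg_ex; exists q.
apply/cvgrPdist_le => e e0.
have e2 : 0 < e / 2 by rewrite divr_gt0.
have [p0 Fp0] := Fc _ e2.
apply: filterS (Fp0) => p; rewrite dual_ball => pp0.
have -> : q - p = (q - p0) + (p0 - p) by rewrite addrA subrK.
rewrite (le_trans (ler_normD _ _))// [e]splitr lerD ?(ltW pp0)//.
rewrite dual_normE; apply: dual_norm_le => x x1.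
rewrite dualBE qL distrC (le_trans (Lle _ _ e2 Fp0 x))//.
by rewrite ler_piMr// ltW.
Qed.

HB.instance Definition _ (X : normedModType R) :=
  Uniform_isComplete.Build (dual X) (@dual_cauchy_cvg X).

(** The open sets [g > n] have empty intersection since [g] is finite, so by Baire one of them is
    not dense and misses a ball. *)
Lemma lsc_bounded_ball (X : completeNormedModType R) (g : X -> R) :
    lower_semicontinuous (fun x : X => (g x)%:E) ->
  exists x0 r M, 0 < r /\ forall x, `|x - x0| < r -> g x <= M.
Proof.
move=> /lower_semicontinuousP lsc.
pose F n := [set x | (n%:R%:E < (g x)%:E)%E].
have [Fdense|/existsNP[n Fn]] := pselect (forall n, dense (F n)).
  have /(_ setT)[||x] := @Baire R X F (fun n => conj (lsc _) (Fdense n)).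
  - by exists 0.
  - exact: openT.
  move=> [_ /(_ (Num.bound `|g x|) I)].
  rewrite /F /= lte_fin ltNge ltW//.
  by apply: le_lt_trans (ler_norm _) _; exact: archi_boundP.
move: Fn => /existsNP[U /not_implyP[[x0 Ux0] /not_implyP[oU UF]]].
have /nbhs_ballP[r r0 rU] : nbhs x0 U by exact: open_nbhs_nbhs.
exists x0, r, n%:R; split => // x xr; rewrite leNgt; apply/negP => nx.
apply: UF; exists x; split; last by rewrite /F /= lte_fin.
by apply: rU; rewrite -ball_normE /= distrC.
Qed.
End Dual.

(** * Gateaux derivatives, subgradients, and separation of points *)

Section Gateaux.
Context {R : realType} {X : normedModType R}.
Implicit Types (g l : X -> R) (d p q : dual X) (x : X).

Lemma gateaux_cvg_right g x d v : is_gateaux g x d ->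
  (h^-1 * (g (x + h *: v) - g x)) @[h --> 0^'+] --> d v.
Proof.
move=> /(_ v) gd; have dg := @ex_derive _ _ _ _ _ _ _ gd.
have <- := @derive_val _ _ _ _ _ _ _ gd.
rewrite (_ : (fun h => _) =
    (fun h : R => h^-1 *: (((g : X -> R^o) \o shift x) (h *: v) - g x))).
  exact: cvg_dnbhs_at_right dg.
by apply/funext => h; rewrite /= [_ *: v + x]addrC.
Qed.

Lemma gateaux_ge g x d v c : is_gateaux g x d ->
  (forall t, 0 < t -> t <= 1 -> t * c <= g (x + t *: v) - g x) -> c <= d v.
Proof.
move=> gd gc; apply: (cvgr_to_ge (gateaux_cvg_right (v := v) gd)).
near=> t; have t0 : 0 < t by near: t; exact: nbhs_right_gt.
rewrite ler_pdivlMl// gc//.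
by near: t; exact: nbhs_right_le.
Unshelve. all: by end_near. Qed.

Lemma gateaux_le g x d v c : is_gateaux g x d ->
  (forall t, 0 < t -> t <= 1 -> g (x + t *: v) - g x <= t * c) -> d v <= c.
Proof.
move=> gd gc; apply: (cvgr_to_le (gateaux_cvg_right (v := v) gd)).
near=> t; have t0 : 0 < t by near: t; exact: nbhs_right_gt.
rewrite ler_pdivrMl// gc//.
by near: t; exact: nbhs_right_le.
Unshelve. all: by end_near. Qed.

(** Positive [t] gives [l v <= d v] and negative [t] the reverse. As [l] is a bare function,
    evaluation at a point of [X] can later serve as a subgradient of [f^*]. *)
Lemma subgradient_gateaux g x d l : is_gateaux g x d ->
    (forall t v, g x + t * l v <= g (x + t *: v)) -> forall v, l v = d v.
Proof.
move=> gd gl v; apply/eqP; rewrite eq_le; apply/andP; split.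
  by apply: (gateaux_ge gd) => t _ _; rewrite lerBrDl.
rewrite -lerN2 -linearN; apply: (gateaux_ge gd) => t _ _.
by rewrite lerBrDl scalerN -scaleNr mulrN -mulNr.
Qed.

Lemma convex_function_fun g : convex_function [set: X] g -> convex_fun g.
Proof.
move=> gconv a b u v a0 b0 ab; have a1 : a <= 1 by lra.
have := gconv (Itv01 a0 a1) u v; rewrite !inE => /(_ I I).
rewrite convRE/= /conv /= /unstable.onem.
by have -> : 1 - a = b by lra.
Qed.

Lemma gateaux_gradient_le g x d : convex_fun g -> is_gateaux g x d ->
  forall y, g x + d (y - x) <= g y.
Proof.
move=> gconv gd y; rewrite -lerBrDl; apply: (gateaux_le gd) => t t0 t1.
have := gconv t (1 - t) y x (ltW t0); rewrite subr_ge0 t1 => /(_ isT).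
rewrite addrC subrK => /(_ erefl).
have -> : t *: y + (1 - t) *: x = x + t *: (y - x).
  by rewrite scalerBl scale1r scalerBr addrCA.
lra.
Qed.

(** Hahn-Banach for the sublinear [y |-> inf (|y + t z| - t |z|)] over [t >= 0]: it is at most
    [|y|], so a linear minorant is continuous, and at most [- |z|] at [- z]. *)
Lemma dual_separates (u v : X) : (forall p : dual X, p u = p v) -> u = v.
Proof.
move=> puv; apply/eqP; rewrite -subr_eq0 -normr_le0; set z := u - v.
pose S := [set y : X * R | exists2 t, 0 <= t & `|y.1 + t *: z| - t * `|z| <= y.2].
have [| |l llin lS] := @graph_cone_dominated_linear R X S.
- split.
  + move=> z1 c1 z2 c2 [t t0 /= tc] [s s0 /= sc].
    exists (t + s) => /=; first exact: addr_ge0.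
    have := ler_normD (z1 + t *: z) (z2 + s *: z).
    rewrite addrACA -scalerDl; lra.
  + move=> a y c a0 [t t0 /= tc]; exists (a * t) => /=; first exact: mulr_ge0.
    rewrite -scalerA -scalerDr normrZ ger0_norm// -mulrA -mulrBr.
    by rewrite ler_wpM2l.
  + move=> c [t t0 /=]; rewrite add0r normrZ ger0_norm//; lra.
- by move=> y; exists `|y|, 0 => //=; rewrite scale0r mul0r addr0 subr0.
have [|p pl] := @linear_dual _ _ l 0 1 1 llin ltr01.
  move=> y; rewrite subr0 => /ltW y1; rewrite (le_trans _ y1)//; apply: lS.
  by exists 0 => //=; rewrite scale0r mul0r addr0 subr0.
have : l (- z) <= - `|z|.
  by apply: lS; exists 1 => //=; rewrite scale1r addNr normr0 mul1r sub0r.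
by rewrite -pl linearN /z linearB/= puv subrr oppr0 lerNr oppr0.
Qed.

(** * The Fenchel conjugate and equality in Fenchel-Young *)

Section Conjugate.
Context (f : X -> R) (f_fin : forall p : dual X, conjugate f p \is a fin_num).
Local Notation fs := (fine \o conjugate f).

Lemma fenchel_young p x : p x - f x <= fs p.
Proof.
rewrite -lee_fin /= fineK//; apply: ereal_sup_ubound; by exists x.
Qed.

Lemma conjugate_le p c : (forall x, p x - f x <= c) -> fs p <= c.
Proof.
move=> pc; rewrite -lee_fin /= fineK//; apply: ge_ereal_sup.
by move=> _ [x _ <-]; rewrite lee_fin.
Qed.

Lemma conjugate_convex : convex_fun fs.
Proof.
move=> a b p q a0 b0 ab; apply: conjugate_le => x.
rewrite dualDE !dualZE.
have := ler_wpM2l a0 (fenchel_young p x).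
have := ler_wpM2l b0 (fenchel_young q x).
have : a * f x + b * f x = f x by rewrite -mulrDl ab mul1r.
rewrite !mulrBr; lra.
Qed.

Lemma conjugate_lsc : lower_semicontinuous (fun p : dual X => (fs p)%:E).
Proof.
move=> p a; rewrite lte_fin => ap.
have [x ax] : exists x, a < p x - f x.
  apply: contrapT => nx; move: ap; apply/negP; rewrite -leNgt.
  apply: conjugate_le => x; rewrite leNgt; apply/negP => ax.
  by apply: nx; exists x.
(* Within this radius [q x] stays closer to [p x] than the slack [p x - f x - a]; the [+ 1] covers
   [x = 0]. *)
pose e := (p x - f x - a) / (`|x| + 1).
have x0 : 0 < `|x| + 1 by rewrite ltr_wpDl.
have e0 : 0 < e by rewrite divr_gt0// subr_gt0.
exists (ball p e); first exact: nbhsx_ballx.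
move=> q; rewrite dual_ball lte_fin => pq.
apply: lt_le_trans (fenchel_young q x).
have : `|(p - q) x| < p x - f x - a.
  move: pq; rewrite ltr_pdivlMr//; apply: le_lt_trans.
  apply: le_trans (dual_normP _ _) _.
  by rewrite ler_wpM2l ?dual_norm_ge0// lerDl.
rewrite dualBE ltr_norml => /andP[_]; lra.
Qed.

(** The gradient inequality says that [p y - f y] is largest at [y = x]. *)
Lemma conjugate_gateaux p x : convex_fun f -> is_gateaux f x p ->
  fs p = p x - f x.
Proof.
move=> fconv fp; apply/eqP; rewrite eq_le fenchel_young andbT.
apply: conjugate_le => y.
have := gateaux_gradient_le fconv fp y; rewrite linearB /=; lra.
Qed.

(** Equality in Fenchel-Young makes [p] a subgradient of [f] at [x], and the Gateaux derivative is
    the only one. *)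
Lemma fenchel_young_eq p d x : is_gateaux f x d -> fs p <= p x - f x -> p = d.
Proof.
move=> fd fsp; apply: dual_eqP; apply: (subgradient_gateaux fd) => t v.
have pt : p (t *: v) = t * p v by rewrite linearZ.
have := fenchel_young p (x + t *: v); move: fsp; rewrite linearD /= pt; lra.
Qed.

End Conjugate.
End Gateaux.

(** Strict monotonicity of [grad f], in the contrapositive form that uniqueness of the resolvent
    calls for. *)
Lemma grad_legendre_inj_mono (R : realType) (X : normedModType R) (f : X -> R)
    (y1 y2 : X) : fully_legendre f ->
  (grad f y1 - grad f y2) (y1 - y2) <= 0 -> y1 = y2.
Proof.
move=> [_ /convex_function_fun fconv fgat ffin fsgat].
have FY := fenchel_young ffin.
have g1 := is_gateaux_grad fgat y1; have g2 := is_gateaux_grad fgat y2.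
have := conjugate_gateaux ffin fconv g2.
move: (fine \o conjugate f) FY fsgat => fs FY fsgat.
move: (grad f y1) (grad f y2) g1 g2 => p1 p2 g1 g2 e2 mono.
(* The gradient inequality at [y1] and the sign hypothesis give [f y1 - f y2 <= p2 (y1 - y2)], which
   carries Fenchel-Young equality from [y2] to [y1]. *)
have e12 : fs p2 = p2 y1 - f y1.
  apply/eqP; rewrite eq_le FY andbT e2.
  have := gateaux_gradient_le fconv g1 y2.
  move: mono; rewrite dualBE !linearB /=; lra.
have [d2 fsd] := fsgat p2.
(* A point attaining [f^*] at [p2] acts, by evaluation, as a subgradient there. *)
have sub y : fs p2 = p2 y - f y -> forall q : dual X, q y = d2 q.
  move=> ey; apply: (subgradient_gateaux fsd) => t q.
  have := FY (p2 + t *: q) y; rewrite dualDE dualZE; lra.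
by apply: dual_separates => p; rewrite (sub y1 e12) (sub y2 e2).
Qed.

(** * Maximality through monotonically related points *)

Section MaximalMonotone.
Context {R : realType} {X : normedModType R}.
Implicit Types A B : X -> set (dual X).

Lemma dualBB (p q : dual X) x a : (p - q) (x - a) = p x - p a - q x + q a.
Proof. rewrite dualBE !linearB /=; lra. Qed.

(** For monotone [B] this is maximality in pointwise form. *)
Definition monotone_closed B := forall x p,
  (forall a q, B a q -> 0 <= (p - q) (x - a)) -> B x p.

(** Otherwise adjoining [(x, p)] would give a properly larger monotone graph. *)
Lemma maximally_monotone_closed A : maximally_monotone A -> monotone_closed A.
Proof.
move=> [Amono Amax] x p xp; apply: contrapT => nAxp.
apply: (Amax (fun y => [set q | A y q \/ (y = x /\ q = p)])).
  move=> y1 y2 q1 q2 /= [A1|[-> ->]] [A2|[-> ->]].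
  - exact: Amono.
  - by have := xp _ _ A1; rewrite -opprB -[x - y1]opprB dualNE linearN opprK.
  - exact: xp.
  - by rewrite !subrr.
split; first by move=> [z q]; left.
by move=> /(_ (x, p)) nA; apply: nAxp; apply: nA; right.
Qed.

(** Over an empty graph the closure condition is vacuous and would put [(0, 0)] in it. *)
Lemma monotone_closed_nonempty B : monotone_closed B -> exists a q, B a q.
Proof.
move=> Bcl; apply: contrapT => nB; apply: (nB); exists 0, 0.
by apply: Bcl => a q Baq; exfalso; apply: nB; exists a, q.
Qed.

Lemma monotone_scale_shift A (t : R) (w : dual X) : 0 < t -> Defs.monotone A ->
  Defs.monotone (fun a => [set t *: s - w | s in A a]).
Proof.
move=> t0 Amono a1 a2 _ _ [s1 A1 <-] [s2 A2 <-].
rewrite opprB addrA subrK -scalerBr dualZE.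
by apply: mulr_ge0; [exact: ltW|exact: Amono].
Qed.

Lemma monotone_closed_scale_shift A (t : R) (w : dual X) : 0 < t ->
  monotone_closed A -> monotone_closed (fun a => [set t *: s - w | s in A a]).
Proof.
move=> t0 Acl x p xp; exists (t^-1 *: (p + w)); last first.
  by rewrite scalerA mulfV ?gt_eqF// scale1r addrK.
apply: Acl => a q Aaq.
have := xp a _ (ex_intro2 _ _ q Aaq erefl).
have -> : p - (t *: q - w) = t *: (t^-1 *: (p + w) - q).
  by rewrite scalerBr scalerA mulfV ?gt_eqF// scale1r opprB addrA.
by rewrite dualZE pmulr_rge0.
Qed.

End MaximalMonotone.

(** * Existence, by the Fitzpatrick function *)

Lemma legendre_opp_grad_in (R : realType) (X : completeNormedModType R)
    (f : X -> R) (B : X -> set (dual X)) :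
    reflexive_space X -> fully_legendre f -> Defs.monotone B -> monotone_closed B ->
  exists y, B y (- grad f y).
Proof.
move=> Xrefl [flsc /convex_function_fun fconv fgat ffin _] Bmono Bcl.
have fsgrad x := conjugate_gateaux ffin fconv (is_gateaux_grad fgat x).
have eq_grad (p : dual X) x :=
  @fenchel_young_eq _ _ _ ffin p _ _ (is_gateaux_grad fgat x).
have := conjugate_lsc ffin; have := conjugate_convex ffin.
have := conjugate_le ffin; have := fenchel_young ffin.
move: (fine \o conjugate f) fsgrad eq_grad => fs fsgrad eq_grad FY fsle fsconv fslsc.
(* Epigraph of the Fitzpatrick function of [B]. *)
pose K := [set z : (X * dual X) * R |
  forall a q, B a q -> q z.1.1 + z.1.2 a - q a <= z.2].
pose g (z : X * dual X) := f z.1 + fs (- z.2).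
have Kgraph a q : B a q -> K ((a, q), q a).
  move=> Baq b r Bbr /=; have := Bmono _ _ _ _ Baq Bbr.
  rewrite dualBE !linearB /=; lra.
have [||||l llin [c [lg lK]]] := @affine_sandwich R (X * dual X)%type K g.
- move=> s t [x1 p1] c1 [x2 p2] c2 s0 t0 st K1 K2 a q Baq /=.
  have := ler_wpM2l s0 (K1 _ _ Baq); have := ler_wpM2l t0 (K2 _ _ Baq).
  have qE : q (s *: x1 + t *: x2) = s * q x1 + t * q x2.
    by rewrite linearD !linearZ.
  have : s * q a + t * q a = q a by rewrite -mulrDl st mul1r.
  rewrite qE => qaE Kq Kp.
  suff : s * q x1 + t * q x2 + (s * p1 a + t * p2 a) - q a <= s * c1 + t * c2.
    by [].
  move: qaE Kq Kp => /=; lra.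
- move=> s t [x1 p1] [x2 p2] s0 t0 st; rewrite /g /=.
  have := fconv s t x1 x2 s0 t0 st.
  have := fsconv s t (- p1) (- p2) s0 t0 st.
  rewrite !scalerN -opprD; lra.
- by have [a [q /Kgraph Kaq]] := monotone_closed_nonempty Bcl; exists ((a, q), q a).
- move=> [x p] t Kxpt; rewrite /g /=.
  (* If [t < p x], then [(x, p)] is monotonically related to [B], hence in its graph; taking
     [(a, q) = (x, p)] in [Kxpt] then gives [p x <= t], a contradiction. *)
  have : p x <= t.
    rewrite leNgt; apply/negP => tp.
    have /Kxpt /= : B x p.
      apply: Bcl => a q /Kxpt /= qt.
      have : 0 <= p x - p a - q x + q a by lra.
      by rewrite -dualBB.
    lra.
  have := FY (- p) x; rewrite dualNE; lra.
pose l1 x : R^o := - l (x, 0).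
pose l2 p : R^o := l (0, p).
have lE x p : l (x, p) = - l1 x + l2 p.
  rewrite /l1 opprK -[l (x, 0)]scale1r -llin; congr l.
  by rewrite [RHS]surjective_pairing /= scale1r scaler0 addr0 add0r.
have l1lin : linear l1.
  move=> a u v; rewrite /l1 scalerN -opprD -llin; congr (- l _).
  by rewrite [RHS]surjective_pairing /= scaler0 addr0.
have l2lin : linear l2.
  move=> a u v; rewrite /l2 -llin; congr l.
  by rewrite [RHS]surjective_pairing /= scaler0 addr0.
have lg' x q : l1 x - f x - l2 q - fs (- q) <= c.
  have := lg (x, q); rewrite lE /g /=; lra.
have l10 : l1 0 = 0 by have := l1lin (-1) 0 0; rewrite !scaleN1r !addNr.
have l20 : l2 0 = 0 by have := l2lin (-1) 0 0; rewrite !scaleN1r !addNr.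
have l2N q : l2 (- q) = - l2 q.
  by have := l2lin (-1) q 0; rewrite !scaleN1r l20 !addr0.
(* With [q = 0], [lg'] bounds [l1] by [f] plus a constant; with [x = 0] it likewise bounds [l2] by
   [f^*] below. *)
have [p1 p1E] : exists p1 : dual X, forall x, p1 x = l1 x.
  have [x0 [r [M [r0 fM]]]] := lsc_bounded_ball flsc.
  apply: (linear_dual (M := M + c + l2 0 + fs (- 0)) l1lin r0) => x /fM.
  have := lg' x 0; lra.
have [phi phiE] : exists phi : dual (dual X), forall p, phi p = l2 p.
  have [q0 [r [M [r0 fsM]]]] := lsc_bounded_ball fslsc.
  apply: (linear_dual (M := M + c + f 0) l2lin r0) => q /fsM.
  have := lg' 0 (- q); rewrite opprK l2N l10; lra.
have [y yE] := Xrefl phi.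
have l2E q : l2 q = q y by rewrite -phiE.
(* At [q = - grad f y] the conjugate is known exactly, and the terms in [grad f y] cancel. *)
have fsp1 : fs p1 <= c - f y.
  apply: fsle => // x.
  have := fsgrad y.
  have := lg' x (- grad f y); rewrite opprK l2N l2E p1E; lra.
(* [lK] at [(a, q)] gives [c <= q a + p1 a - q y], while [fsp1] and Fenchel-Young give
   [p1 y <= c]. *)
have By : B y (- p1).
  apply: Bcl => a q Baq.
  have := lK _ _ (Kgraph _ _ Baq); rewrite lE l2E -p1E.
  have := FY p1 y; rewrite dualBE !dualNE !linearB /=; lra.
exists y; suff -> : grad f y = p1 by [].
(* [lK] at the graph point [(y, - p1)] itself gives [c <= p1 y], so [fsp1] becomes equality in
   Fenchel-Young. *)
apply/esym/eq_grad.
have := lK _ _ (Kgraph _ _ By); rewrite lE l2E -p1E dualNE; lra.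
Qed.

Lemma resolvent_surjective (R : realType) (X : completeNormedModType R)
    (f : X -> R) (A : X -> set (dual X)) (t : R) (w : dual X) :
    reflexive_space X -> fully_legendre f -> maximally_monotone A -> 0 < t ->
  exists y s, A y s /\ grad f y + t *: s = w.
Proof.
move=> Xrefl fL Amax t0.
(* The equation is rewritten as [- grad f y = t *: s - w]. *)
have [y [s As sE]] := legendre_opp_grad_in Xrefl fL
  (monotone_scale_shift (w := w) t0 Amax.1)
  (monotone_closed_scale_shift (w := w) t0 (maximally_monotone_closed Amax)).
by exists y, s; split => //; rewrite -[grad f y]opprK -sE opprB subrK.
Qed.

(** * The resolvent, the inclusion and the system *)

Theorem proposition4p2 (R : realType) (X : completeNormedModType R)
  (f : X -> R) (A : X -> set (dual X))
  (X_reflexive : reflexive_space X)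
  (f_legendre : fully_legendre f)
  (A_maxmono : maximally_monotone A)
  (x : X) (eta : dual X) (lambda : R) (lambda_gt0 : 0 < lambda) :
  let resolvent := op_inv (op_add (op_fun (grad f)) (op_scale lambda A)) in
  let inclusion (y : X) :=
    set_add (A y) [set (1 / lambda) *: (grad f y - grad f x)] eta in
  let system (y : X) (xi : dual X) :=
    A y xi /\ eta = xi + (1 / lambda) *: (grad f y - grad f x) in
  [/\ exists! y : X, inclusion y,
      exists! z : X * dual X, system z.1 z.2,
      single_valued resolvent,
      forall y : X, inclusion y ->
        resolvent (lambda *: eta + grad f x) = [set y] &
      forall (y : X) (xi : dual X), system y xi ->
        resolvent (lambda *: eta + grad f x) = [set y] /\
        xi = eta - (1 / lambda) *: (grad f y - grad f x)].
Proof.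
move=> resolvent inclusion system.
have resP w y : resolvent w y <-> exists2 s, A y s & grad f y + lambda *: s = w.
  split; first by move=> [_ -> [_ [s As <-] <-]]; exists s.
  by move=> [s As <-]; exists (grad f y) => //; exists (lambda *: s) => //; exists s.
have res_uniq w y1 y2 : resolvent w y1 -> resolvent w y2 -> y1 = y2.
  move=> /resP[s1 A1 <-] /resP[s2 A2 e].
  apply: (grad_legendre_inj_mono f_legendre).
  (* Two preimages of [w] have opposite increments of [grad f] and [lambda A]; monotonicity of [A]
     supplies the sign. *)
  have -> : grad f y1 - grad f y2 = - (lambda *: (s1 - s2)).
    rewrite scalerBr opprB; apply/eqP.
    by rewrite subr_eq addrAC [_ + grad f y2]addrC e addrK.
  rewrite dualNE dualZE oppr_le0.
  by apply: mulr_ge0; [exact: ltW|exact: A_maxmono.1].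
have res_ex w : exists y, resolvent w y.
  have [y [s [As sE]]] :=
    resolvent_surjective w X_reflexive f_legendre A_maxmono lambda_gt0.
  by exists y; apply/resP; exists s.
(* Multiplication by [lambda] turns the system into the resolvent equation. *)
have sysP y xi : system y xi <->
    A y xi /\ grad f y + lambda *: xi = lambda *: eta + grad f x.
  have l0 : lambda != 0 by rewrite gt_eqF.
  split=> -[Axi e]; split => //.
    by rewrite e scalerDr div1r scalerA mulfV// scale1r addrA subrK addrC.
  rewrite div1r -[xi](scalerK l0) -scalerDr.
  have -> : lambda *: xi + (grad f y - grad f x) = lambda *: eta.
    by rewrite addrA [_ + grad f y]addrC e addrK.
  by rewrite scalerK.
have incP y : inclusion y <-> exists xi, system y xi.
  split; first by move=> [xi Axi [_ -> e]]; exists xi.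
  move=> [xi [Axi e]]; exists xi => //.
  by exists ((1 / lambda) *: (grad f y - grad f x)).
have incR y : inclusion y <-> resolvent (lambda *: eta + grad f x) y.
  split; first by move=> /incP[xi /sysP[Axi e]]; apply/resP; exists xi.
  by move=> /resP[xi Axi e]; apply/incP; exists xi; apply/sysP.
have sysE y xi : system y xi -> xi = eta - (1 / lambda) *: (grad f y - grad f x).
  by move=> [_ e]; rewrite {1}e addrK.
have res1 y : inclusion y -> resolvent (lambda *: eta + grad f x) = [set y].
  move=> /incR ry; apply/seteqP; split => z /=; last by move=> ->.
  by move=> rz; exact: res_uniq rz ry.
have [y0 ry0] := res_ex (lambda *: eta + grad f x).
have iy0 := (incR y0).2 ry0.
have [xi0 sys0] := (incP y0).1 iy0.
split => //.
- exists y0; split => // y /incR; exact: res_uniq.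
- exists (y0, xi0); split => // -[y xi] /= sys.
  have yE : y0 = y by apply: res_uniq ry0 _; apply/incR/incP; exists xi.
  by subst y; rewrite (sysE _ _ sys0) (sysE _ _ sys).
- move=> w; have [y ry] := res_ex w; exists y; split => // z; exact: res_uniq.
- move=> y xi sys; split; last exact: sysE.
  by apply: res1; apply/incP; exists xi.
Qed.
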